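(* Consider the online removable multiple knapsack problem, in either the proportional case (each item's value equals its size) or the unit case (each item's value is $1$). Let $A$ be any deterministic online algorithm that is defined for every number $k \geq 2$ of bins. Then the competitive ratio of $A$, i.e. $\sup_{k\ge 2}\sup_{I} \frac{\mathrm{OPT}_k(I)}{A_k(I)}$, is at least $1.228713$.
   Context: Online removable multiple knapsack: there are $k$ bins (knapsacks), each of capacity $1$. Items arrive one by one; each item has a size in $(0,1]$ and a value. Upon arrival of an item, the online algorithm must either reject it or pack it into one of the bins; at any time the algorithm may also remove previously packed items from their bins, after which they count as rejected forever. At all times the total size of items in each bin must be at most $1$. The profit $A_k(I)$ of the algorithm on input $I$ with $k$ bins is the total value of items packed at the end. $\mathrm{OPT}_k(I)$ denotes the maximum total value of a subset of the items of $I$ that can be packed into $k$ bins of capacity $1$. In the proportional case each item's value equals its size; in the unit case each item's value is $1$. The competitive ratio (a maximization problem) is the supremum over inputs of $\mathrm{OPT}/\mathrm{ALG}$. *)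

(* Defs.v *)
From mathcomp Require Import all_boot all_order all_algebra.
From mathcomp Require Import all_classical all_reals all_analysis.

Set Implicit Arguments.
Unset Strict Implicit.
Unset Printing Implicit Defensive.

Import Order.TTheory GRing.Theory Num.Theory.

Local Open Scope classical_set_scope.
Local Open Scope ring_scope.

Inductive variant := Proportional | Unit.

Record item (R : realType) := Item { item_size : R; item_value : R }.

Definition valid_item (R : realType) (v : variant) (x : item R) : bool :=
  (0 < item_size x <= 1) &&
  (item_value x == if v is Proportional then item_size x else 1).

Definition valid_input (R : realType) (v : variant) (I : seq (item R)) : bool :=
  all (valid_item v) I.

(* A packing of the input [I] into [k] bins is a sequence [p] parallel to [I]:
   the [i]-th entry of [p] is [Some b] if the [i]-th item is in bin [b], and
   [None] if that item is not packed (rejected or removed). *)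
Definition load (R : realType) (k : nat) (I : seq (item R))
    (p : seq (option 'I_k)) (b : 'I_k) : R :=
  \sum_(u <- zip I p | u.2 == Some b) item_size u.1.

Definition profit (R : realType) (k : nat) (I : seq (item R))
    (p : seq (option 'I_k)) : R :=
  \sum_(u <- zip I p | u.2 != None) item_value u.1.

Definition is_packing (R : realType) (k : nat) (I : seq (item R))
    (p : seq (option 'I_k)) : bool :=
  (size p == size I) && [forall b, load I p b <= 1].

(* The default value [0] is also the profit of the empty packing. *)
Definition OPT (R : realType) (k : nat) (I : seq (item R)) : R :=
  \big[Num.max/0]_(p : (size I).-tuple (option 'I_k) | is_packing I p)
    profit I p.

(* A deterministic algorithm is the map sending the sequence of items that have
   arrived so far to the current packing of these items. When an item arrives,
   each earlier item stays where it was or is removed: in particular it cannot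
   change bins, and an item that is not packed never becomes packed again. *)
Definition online_algorithm (R : realType) (v : variant) (k : nat)
    (A : seq (item R) -> seq (option 'I_k)) : Prop :=
  (forall I, valid_input v I -> is_packing I (A I)) /\
  (forall I x, valid_input v (rcons I x) -> forall i, (i < size I)%N ->
     nth None (A (rcons I x)) i = nth None (A I) i \/
     nth None (A (rcons I x)) i = None).

(* Division in [\bar R]: a positive number divided by [0] is [+oo], and [0 / 0],
   which occurs only for the empty input, is [0]. *)
Definition competitive_ratio (R : realType) (v : variant)
    (A : forall k : nat, seq (item R) -> seq (option 'I_k)) : \bar R :=
  ereal_sup [set ereal_sup
      [set ((OPT k I)%:E / (profit I (A k I))%:E)%E
         | I in [set I | valid_input v I]]
    | k in [set k | (2 <= k)%N]].

(* Main.v *)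
Require Import Defs.
From mathcomp Require Import all_boot all_order all_algebra.
From mathcomp Require Import all_classical all_reals all_analysis.
From mathcomp Require Import lra.

Set Implicit Arguments.
Unset Strict Implicit.
Unset Printing Implicit Defensive.

Import Order.TTheory GRing.Theory Num.Theory.

(** Two bins suffice, and both variants are treated at once. If the ratio were
below 5/4, the algorithm would have to keep every item of any input that fits
into the two bins and each of whose items carries at least a fifth of the total
value. After items of sizes 1/2 and 2/5, offering 1 therefore forces these two
to share a bin; offering 3/5 and 1/2 instead (which fit as 1/2 + 1/2 and
2/5 + 3/5) is then impossible to serve, although the algorithm cannot yet tell
the two continuations apart. *)

Local Open Scope ring_scope.

Section Packings.
Context {R : realType} {k : nat}.
Implicit Types (I : seq (item R)) (p : seq (option 'I_k)).

Lemma profit_le_OPT I p : is_packing I p -> profit I p <= OPT k I.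
Proof.
move=> pI; have /andP[sz _] := pI.
exact: (le_bigmax_cond _ (fun q : (size I).-tuple _ => profit I q)
  (j := Tuple sz)).
Qed.

Lemma profit_ge0 v I p : valid_input v I -> 0 <= profit I p.
Proof.
elim: I p => [|x I IH] [|o p]; rewrite /profit ?big_nil //=.
move=> /andP[/andP[/andP[x0 _] /eqP xv] vI]; rewrite big_cons /=.
have vx : 0 <= item_value x by rewrite xv; case: (v) => //; exact: ltW.
by case: ifP => _; rewrite ?addr_ge0 //; exact: IH.
Qed.

Lemma profit_le_sum I p : all (fun x => 0 <= item_value x) I ->
  profit I p <= \sum_(x <- I) item_value x.
Proof.
elim: I p => [|x I IH] p; first by rewrite /profit; case: p => *; rewrite !big_nil.
move=> /andP[x0 I0]; rewrite big_cons; case: p => [|o p].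
  have := IH [::] I0; rewrite /profit; case: (I) => [|? ?]; rewrite /= !big_nil; lra.
by have := IH p I0; rewrite /profit /= big_cons; case: ifP => _; lra.
Qed.

(** The unpacked item forfeits at least [c]. Equal sizes ensure that the [None] entry faces an item
    instead of being cut off by [zip]. *)
Lemma profit_None (c : R) I p : 0 <= c -> all (fun x => c <= item_value x) I ->
  None \in p -> size p = size I ->
  profit I p + c <= \sum_(x <- I) item_value x.
Proof.
move=> c0; elim: I p => [|x I IH] [|o p] //= /andP[cx cI] + [sz].
rewrite inE /profit !big_cons /=; case: o => [b|] /=.
  by move=> /(IH _ cI)/(_ sz); rewrite /profit; lra.
have I0 : all (fun y => 0 <= item_value y) I.
  by apply: sub_all cI => y; exact: le_trans.
by move=> _; have := profit_le_sum p I0; rewrite /profit; lra.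
Qed.

Lemma lt_competitive_ratio v (A : forall k, seq (item R) -> seq (option 'I_k))
    (c : R) I p :
  (2 <= k)%N -> (competitive_ratio v A < c%:E)%E -> valid_input v I ->
  is_packing I p -> 0 < profit I p -> profit I p < c * profit I (A k I).
Proof.
move=> k2 ratio vI pI p0.
have : ((OPT k I)%:E / (profit I (A k I))%:E < c%:E)%E.
  apply: le_lt_trans ratio.
  apply: (le_trans _ (ereal_sup_ubound _)); last by exists k.
  by apply: ereal_sup_ubound; exists I.
have pOPT := profit_le_OPT pI; have OPT0 := lt_le_trans p0 pOPT.
(* If the algorithm earns nothing, the quotient is [+oo], since OPT is positive; this contradicts
   the finite bound [c]. *)
have [A0|An0] := eqVneq (profit I (A k I)) 0.
  by rewrite A0 inve0 mulry gtr0_sg ?mul1e.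
have A0 : 0 < profit I (A k I) by rewrite lt_def An0 (profit_ge0 _ vI).
rewrite inver (negbTE An0) -EFinM lte_fin ltr_pdivrMr //.
exact: le_lt_trans.
Qed.

(** With total value [T <= 5 * c], a missing item leaves at most [T - c <= 4/5 * T], while [p] earns
    all of [T]: the ratio would reach 5/4. *)
Lemma packs_all v (A : forall k, seq (item R) -> seq (option 'I_k)) (c : R) I p :
  (2 <= k)%N -> online_algorithm v (A k) ->
  (competitive_ratio v A < (5 / 4)%:E)%E -> valid_input v I ->
  is_packing I p -> profit I p = \sum_(x <- I) item_value x ->
  0 < c -> all (fun x => c <= item_value x) I ->
  0 < \sum_(x <- I) item_value x <= 5 * c ->
  None \notin A k I.
Proof.
move=> k2 [packA _] ratio vI pI pE c0 cI /andP[t0 t5]; apply/negP => AN.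
have := @lt_competitive_ratio v A _ _ _ k2 ratio vI pI; rewrite pE => /(_ t0).
have /andP[/eqP sz _] := packA _ vI.
by have := profit_None (ltW c0) cI AN sz; lra.
Qed.

(** Each arrival keeps an item in place or drops it for good, so an item that survives to the end
    has never moved. *)
Lemma online_prefix v (A : seq (item R) -> seq (option 'I_k)) I J i :
  online_algorithm v A -> valid_input v (I ++ J) -> (i < size I)%N ->
  nth None (A (I ++ J)) i != None -> nth None (A I) i = nth None (A (I ++ J)) i.
Proof.
move=> [_ onA] + iI; elim/last_ind: J => [|J x IH]; first by rewrite cats0.
rewrite -rcons_cat => vIJ.
have iIJ : (i < size (I ++ J))%N by rewrite size_cat ltn_addr.
have [->|->] := onA _ _ vIJ i iIJ; last by [].
by apply: IH; move: vIJ; rewrite /valid_input all_rcons => /andP[].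
Qed.

End Packings.

Theorem theorem1 (R : realType) (v : variant)
    (A : forall k : nat, seq (item R) -> seq (option 'I_k))
    (hA : forall k : nat, (2 <= k)%N -> online_algorithm v (A k)) :
  ((1228713%:R / 1000000%:R)%:E <= competitive_ratio v A)%E.
Proof.
apply: (@le_trans _ _ (5 / 4)%:E); first by rewrite lee_fin; lra.
rewrite leNgt; apply/negP => ratio.
pose it (s : R) := Item s (if v is Proportional then s else 1).
pose prefix := [:: it (1 / 2); it (2 / 5)].
pose I1 := prefix ++ [:: it 1]; pose I2 := prefix ++ [:: it (3 / 5); it (1 / 2)].
have valid_it s : 0 < s <= 1 -> valid_item v (it s).
  by rewrite /valid_item /= => ->; rewrite eqxx.
have v1 : valid_input v I1 by rewrite /= !valid_it //; lra.
have v2 : valid_input v I2 by rewrite /= !valid_it //; lra.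
have bin2 (P : 'I_2 -> bool) : P ord0 -> P ord_max -> [forall b, P b].
  by move=> P0 P1; apply/forallP => -[[|[|//]] lt_b];
    [move: P0 | move: P1]; congr (P _); exact: val_inj.
have onA := hA 2 isT.
have [c [c0 [c1 c2]]] : exists c : R, 0 < c /\
    (all (fun x => c <= item_value x) I1 /\
     0 < \sum_(x <- I1) item_value x <= 5 * c) /\
    (all (fun x => c <= item_value x) I2 /\
     0 < \sum_(x <- I2) item_value x <= 5 * c).
  (* The least item value. In the proportional case the totals are 19/10 and 2, the latter exactly
     [5 * c]; in the unit case they are 3 and 4. *)
  exists (if v is Proportional then 2 / 5 else 1).
  by rewrite /= !big_cons !big_nil /=; case: (v); lra.
have all1 : None \notin A 2 I1.
  have [ge_c sum_c] := c1.
  apply: (packs_all (p := [:: Some ord0; Some ord0; Some ord_max])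
    (isT : (1 < 2)%N) onA ratio v1 _ _ c0 ge_c sum_c).
  - by rewrite /is_packing /=; apply: (bin2 (fun b => load _ _ b <= 1));
      rewrite /load /= !big_cons !big_nil /=; lra.
  - by rewrite /profit /= !big_cons !big_nil.
have all2 : None \notin A 2 I2.
  have [ge_c sum_c] := c2.
  apply: (packs_all (p := [:: Some ord0; Some ord_max; Some ord_max; Some ord0])
    (isT : (1 < 2)%N) onA ratio v2 _ _ c0 ge_c sum_c).
  - by rewrite /is_packing /=; apply: (bin2 (fun b => load _ _ b <= 1));
      rewrite /load /= !big_cons !big_nil /=; lra.
  - by rewrite /profit /= !big_cons !big_nil.
have keep0 I : None \notin A 2 I -> forall i, (i < size (A 2 I))%N ->
    nth None (A 2 I) i != None.
  by move=> AN i iA; apply: contraNneq AN => <-; exact: mem_nth.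
have /andP[/eqP sz1 /forallP load1] := onA.1 _ v1.
have /andP[/eqP sz2 /forallP load2] := onA.1 _ v2.
have pre1 i : (i < 2)%N -> nth None (A 2 prefix) i = nth None (A 2 I1) i.
  move=> i2; apply: (online_prefix onA v1) => //.
  by apply: keep0; rewrite ?sz1 //; exact: leq_trans i2 _.
have pre2 i : (i < 2)%N -> nth None (A 2 prefix) i = nth None (A 2 I2) i.
  move=> i2; apply: (online_prefix onA v2) => //.
  by apply: keep0; rewrite ?sz2 //; exact: leq_trans i2 _.
(* Both final packings place the first two items as the packing of [prefix] does, hence in the same
   bins. *)
have := pre1 1 isT; have := pre1 0 isT; rewrite !pre2 //.
case: (A 2 I1) sz1 load1 all1 => [|[a|] [|[b|] [|[c'|] []]]] //= _ load1 _.
case: (A 2 I2) sz2 load2 all2 =>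
  [|[d|] [|[e|] [|[f|] [|[g|] []]]]] //= _ load2 _ [da] [eb].
subst d e.
have two (x y z : 'I_2) : x != z -> y != z -> x = y.
  by case: x y z => [[|[|//]] ?] [[|[|//]] ?] [[|[|//]] ?] //= _ _; exact: val_inj.
(* The item of size 1 fills bin [c'], so the first two items share the other bin. *)
have ac : a != c'.
  apply/negP => /eqP ac; move: (load1 a).
  by rewrite /load /= !big_cons big_nil /= ac eqxx; case: ifP => _; lra.
have bc : b != c'.
  apply/negP => /eqP bc; move: (load1 b).
  by rewrite /load /= !big_cons big_nil /= bc eqxx; case: ifP => _; lra.
have ab := two _ _ _ ac bc; subst b.
(* On [I2], bin [a] already carries 1/2 + 2/5 = 9/10, so 3/5 and 1/2 must both go to the other bin,
   where 11/10 overflows. *)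
have fa : f != a.
  apply/negP => /eqP fa; move: (load2 a).
  by rewrite /load /= !big_cons big_nil /= fa eqxx; case: ifP => _; lra.
have ga : g != a.
  apply/negP => /eqP ga; move: (load2 a).
  by rewrite /load /= !big_cons big_nil /= ga eqxx; case: ifP => _; lra.
have fg := two _ _ _ fa ga; move: (load2 g).
by rewrite /load /= !big_cons big_nil /= fg eqxx; do ?case: ifP => _; lra.
Qed.
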